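(* Let $\mathcal{L}\subseteq\mathbb{R}^n$ be a subspace and $\mathcal{K} = \mathcal{K}^1 \times \mathcal{K}^2\subseteq\mathbb{R}^n$ be a closed convex cone such that $\mathcal{K}^2$ is polyhedral. Then $$\mathcal{K}^* \cap \mathcal{L}^{\perp} \subseteq \left(\mathrm{lin}\,((\mathcal{K}^1)^* )\right) \times (\mathcal{K}^2)^* \quad\Longleftrightarrow\quad \left( (\mathrm{ri}\,\mathcal{K}^1)\times \mathcal{K}^2 \right)\cap \mathcal{L} \neq \emptyset .$$
   Context: Here $\mathcal{K}^1\subseteq\mathbb{R}^{n_1}$, $\mathcal{K}^2\subseteq\mathbb{R}^{n_2}$ are (nonempty) closed convex cones and $n=n_1+n_2$. $\mathrm{ri}$ is the relative interior; $\mathcal{C}^*=\{s : \langle s,x\rangle\ge 0\ \forall x\in\mathcal{C}\}$ is the dual cone of a cone $\mathcal{C}$; $\mathrm{lin}\,\mathcal{C}=\mathcal{C}\cap(-\mathcal{C})$ is its lineality space; $\mathcal{L}^\perp$ is the orthogonal complement. *)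

(* Defs.v *)
From HB Require Import structures.
From mathcomp Require Import all_boot all_order all_algebra.
From mathcomp Require Import all_classical all_reals.
From mathcomp Require Import topology normedtype convex.

Set Implicit Arguments.
Unset Strict Implicit.
Unset Printing Implicit Defensive.

Import Order.TTheory GRing.Theory Num.Theory.
Import numFieldNormedType.Exports.

Local Open Scope classical_set_scope.
Local Open Scope ring_scope.

Section ConvexCones.
Variable R : realType.

(* [dotmx] of mathcomp's [spectral] needs a closed field of scalars. *)
Definition dot n (u v : 'rV[R]_n) : R := \sum_i u 0 i * v 0 i.

Definition convex_cone n (C : set 'rV[R]_n) : Prop :=
  [/\ C !=set0, convex_set C & forall t x, 0 <= t -> C x -> C (t *: x)].

Definition polyhedral n (C : set 'rV[R]_n) : Prop :=
  exists (m : nat) (a : 'I_m -> 'rV[R]_n) (b : 'I_m -> R),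
    C = [set x | forall i, b i <= dot (a i) x].

Definition dual n (C : set 'rV[R]_n) : set 'rV[R]_n :=
  [set s | forall x, C x -> 0 <= dot s x].

Definition lin n (C : set 'rV[R]_n) : set 'rV[R]_n :=
  C `&` [set x | C (- x)].

Definition orth n (L : {vspace 'rV[R]_n}) : set 'rV[R]_n :=
  [set s | forall x, x \in L -> dot s x = 0].

Definition aff n (C : set 'rV[R]_n) : set 'rV[R]_n :=
  [set y | exists (k : nat) (l : 'I_k -> R) (x : 'I_k -> 'rV[R]_n),
    [/\ forall i, C (x i), \sum_i l i = 1 & y = \sum_i l i *: x i]].

(* [within (aff C) (nbhs x)] is the neighborhood filter of [x] relative to
   [aff C], so this is the interior of [C] in its affine hull. *)
Definition ri n (C : set 'rV[R]_n) : set 'rV[R]_n :=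
  [set x | C x /\ within (aff C) (nbhs x) C].

(* R^n1 x R^n2 is identified with R^(n1 + n2) by concatenation [row_mx]. *)
Definition prodset n1 n2 (A : set 'rV[R]_n1) (B : set 'rV[R]_n2) :
    set 'rV[R]_(n1 + n2) :=
  [set x | A (lsubmx x) /\ B (rsubmx x)].

End ConvexCones.

(* Main.v *)
(** Apply a mixed theorem of the alternative to [K1 x R^n2] and the functionals
    [l], [-l] ([l] spanning the orthogonal of [L]) and the facets of [K2]: either
    a relatively interior point satisfies all the inequalities, which is a point
    of [(ri K1 x K2) /\ L], or some nonnegative combination of the functionals is
    nonpositive on [K1 x R^n2] without vanishing there.  Such a combination has
    no [R^n2] component, and its opposite plus the [K2^*] part is an element of
    [K^* /\ orth L] whose first component is not in [lin K1^*].

    The alternative is proved by induction on the number of functionals, cutting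
    the cone by the half-space [f >= 0] and by the hyperplane [f = 0], so that
    no separation theorem is needed.  Conversely a functional that is nonnegative
    on [K1] and vanishes at a relatively interior point vanishes on [K1]. *)
Require Import Defs.
From mathcomp Require Import all_boot all_order all_algebra.
From mathcomp Require Import all_classical all_reals.
From mathcomp Require Import interval_inference topology normedtype convex lra.

Set Implicit Arguments.
Unset Strict Implicit.
Unset Printing Implicit Defensive.

Import Order.TTheory GRing.Theory Num.Theory.
Import numFieldNormedType.Exports.
Local Open Scope classical_set_scope.
Local Open Scope ring_scope.

(** * The inner product, and functionals cutting out a subspace *)

Lemma dotC (R : realType) n (u v : 'rV[R]_n) : dot u v = dot v u.
Proof. by apply: eq_bigr => i _; rewrite mulrC. Qed.

Lemma dotDr (R : realType) n (u v w : 'rV[R]_n) :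
  dot u (v + w) = dot u v + dot u w.
Proof. by rewrite -big_split; apply: eq_bigr => i _; rewrite mxE mulrDr. Qed.

Lemma dotZr (R : realType) n t (u v : 'rV[R]_n) : dot u (t *: v) = t * dot u v.
Proof. by rewrite big_distrr; apply: eq_bigr => i _; rewrite mxE mulrCA. Qed.

Lemma dotDl (R : realType) n (u v w : 'rV[R]_n) :
  dot (u + v) w = dot u w + dot v w.
Proof. by rewrite dotC dotDr !(dotC w). Qed.

Lemma dotZl (R : realType) n t (u v : 'rV[R]_n) : dot (t *: u) v = t * dot u v.
Proof. by rewrite dotC dotZr dotC. Qed.

Lemma dotNr (R : realType) n (u v : 'rV[R]_n) : dot u (- v) = - dot u v.
Proof. by rewrite -scaleN1r dotZr mulN1r. Qed.

Lemma dotNl (R : realType) n (u v : 'rV[R]_n) : dot (- u) v = - dot u v.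
Proof. by rewrite dotC dotNr dotC. Qed.

Lemma dot0r (R : realType) n (u : 'rV[R]_n) : dot u 0 = 0.
Proof. by rewrite -(scale0r 0) dotZr mul0r. Qed.

Lemma dot0l (R : realType) n (u : 'rV[R]_n) : dot 0 u = 0.
Proof. by rewrite dotC dot0r. Qed.

Lemma dot_le0_eq0 (R : realType) n (u : 'rV[R]_n) :
  dot u u <= 0 -> u = 0.
Proof.
move=> u0; have := u0; rewrite le_eqVlt ltNge sumr_ge0 ?orbF; last first.
  by move=> i _; rewrite -expr2 sqr_ge0.
rewrite psumr_eq0 => [/allP ui0|i _]; last by rewrite -expr2 sqr_ge0.
apply/rowP => i; rewrite mxE; apply/eqP.
by have := ui0 i; rewrite mem_index_enum mulf_eq0 orbb; exact.
Qed.

Lemma dot_split (R : realType) n1 n2 (u v : 'rV[R]_(n1 + n2)) :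
  dot u v = dot (lsubmx u) (lsubmx v) + dot (rsubmx u) (rsubmx v).
Proof.
by rewrite /dot big_split_ord; congr (_ + _); apply: eq_bigr => i _; rewrite !mxE.
Qed.

(** The functionals are the coordinates of [x - projv L x]: they vanish on [L], and all vanish only
    at fixed points of the projection. The projection need not be orthogonal. *)
Lemma orth_separates (R : realType) n (L : {vspace 'rV[R]_n}) :
  exists s : seq 'rV[R]_n, {in s, forall l, orth L l} /\
    forall x, {in s, forall l, dot l x = 0} -> x \in L.
Proof.
pose u x := x - projv L x.
pose l j : 'rV[R]_n := \row_i u (delta_mx 0 i) 0 j.
have dotl j x : dot (l j) x = u x 0 j.
  have -> : u x = \sum_i x 0 i *: u (delta_mx 0 i).
    rewrite /u {1 2}(row_sum_delta x) linear_sum -sumrB.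
    by apply: eq_bigr => i _; rewrite linearZ scalerBr.
  by rewrite summxE; apply: eq_bigr => i _; rewrite !mxE mulrC.
exists [seq l j | j : 'I_n]; split=> [_ /mapP[j _ ->] x xL|x s0].
  by rewrite dotl /u projv_id // subrr mxE.
suff -> : x = projv L x by exact: memv_proj.
apply/eqP; rewrite -subr_eq0; apply/eqP/rowP => j.
by rewrite -[LHS]dotl mxE s0 // map_f // mem_enum.
Qed.

(** * Convex cones and their algebraic relative interior *)

Lemma convex_coneP (R : realType) n (C : set 'rV[R]_n) :
  convex_cone C <-> [/\ C 0, forall x y, C x -> C y -> C (x + y)
                     & forall t x, 0 <= t -> C x -> C (t *: x)].
Proof.
split=> [[[x0 Cx0] cC sC]|[C0 aC sC]]; split => //.
- by rewrite -(scale0r x0); exact: sC.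
- move=> x y Cx Cy.
  have half0 : 0 <= 2^-1 :> R by lra.
  have half1 : 2^-1 <= 1 :> R by lra.
  have Cxy : C (2^-1 *: x + (1 - 2^-1) *: y).
    exact: set_mem (cC x y (Itv01 half0 half1) (mem_set Cx) (mem_set Cy)).
  have := sC 2 _ (ler0n _ 2) Cxy.
  rewrite scalerDr !scalerA.
  have -> : 2 * 2^-1 = 1 :> R by lra.
  have -> : 2 * (1 - 2^-1) = 1 :> R by lra.
  by rewrite !scale1r.
- by exists 0.
- move=> x y t /set_mem Cx /set_mem Cy; apply/mem_set.
  change (C (t%:num *: x + (1 - t%:num) *: y)).
  by apply/aC; apply: sC => //; rewrite subr_ge0.
Qed.

(* For a convex cone, subtracting a small multiple of [y] may replace moving
   from [x] away from [y], so this is the algebraic relative interior. *)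
Definition icr (R : realType) n (C : set 'rV[R]_n) : set 'rV[R]_n :=
  [set x | C x /\ forall y, C y -> exists2 e, 0 < e & C (x - e *: y)].

Lemma icrD (R : realType) n (C : set 'rV[R]_n) x y :
  convex_cone C -> icr C x -> C y -> icr C (x + y).
Proof.
move=> /convex_coneP[_ aC _] [Cx ix] Cy; split; first exact: aC.
move=> z /ix[e e0 Cz]; exists e => //.
by rewrite addrAC; exact: aC.
Qed.

(** Inside [D] one can subtract some [e *: p] from [x]; inside [C] the recovered [e *: p] then
    absorbs a small multiple of any [y]. *)
Lemma icr_subcone (R : realType) n (C D : set 'rV[R]_n) p :
  convex_cone C -> D `<=` C -> D p -> icr C p -> icr D `<=` icr C.
Proof.
move=> coneC DC Dp ip x [Dx ix].
have [e e0 /DC Cxp] := ix p Dp.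
have [C0 aC sC] := (convex_coneP _).1 coneC.
split=> [|y Cy]; first exact: DC.
have [d d0 Cpy] := ip.2 y Cy.
exists (e * d); first exact: mulr_gt0.
have -> : x - (e * d) *: y = (x - e *: p) + e *: (p - d *: y).
  by rewrite scalerBr scalerA addrA subrK.
by apply/aC => //; apply: sC => //; exact: ltW.
Qed.

(* Any [mu] between the ratios [- g / f] over [f < 0] and those over [0 < f] is
   suitable: a combination of two points cancelling [f] shows they are ordered. *)
Lemma dot_ker_multiplier (R : realType) n (C : set 'rV[R]_n) f g y z :
  convex_cone C -> C y -> dot f y < 0 -> C z -> 0 < dot f z ->
  (forall x, C x -> dot f x = 0 -> dot g x <= 0) ->
  exists mu, forall x, C x -> dot g x + mu * dot f x <= 0.
Proof.
move=> /convex_coneP[_ aC sC] Cy fy Cz fz g0.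
pose E := [set r | exists x, [/\ C x, dot f x < 0 & r = dot g x / - dot f x]].
have ubE x : C x -> 0 < dot f x -> ubound E (- dot g x / dot f x).
  move=> Cx fx r [w [Cw fw ->]].
  rewrite ler_pdivrMr ?oppr_gt0 // mulrAC ler_pdivlMr //.
  have := g0 (- dot f w *: x + dot f x *: w).
  rewrite !dotDr !dotZr => h.
  suff : - dot f w * dot g x + dot f x * dot g w <= 0 by lra.
  apply: h; last by lra.
  by apply/aC; apply: sC => //; lra.
have supE : has_ubound E by exists (- dot g z / dot f z); exact: ubE.
have E0 : E !=set0 by exists (dot g y / - dot f y), y.
exists (sup E) => x Cx.
have [fx|fx|fx] := ltgtP (dot f x) 0.
- have : dot g x / - dot f x <= sup E by apply: ub_le_sup => //; exists x.
  by rewrite ler_pdivrMr ?oppr_gt0 //; lra.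
- have : sup E <= - dot g x / dot f x by apply: ge_sup => //; exact: ubE.
  by rewrite ler_pdivlMr //; lra.
- by rewrite fx mulr0 addr0; exact: g0.
Qed.

(* [P] stands for the convex cone generated by [s]. *)
Lemma mixed_alternative (R : realType) n (C P : set 'rV[R]_n)
    (s : seq 'rV[R]_n) :
  convex_cone C -> icr C !=set0 -> convex_cone P -> {in s, forall a, P a} ->
  (exists2 x, icr C x & {in s, forall a, 0 <= dot a x}) \/
  (exists g, [/\ P g, forall x, C x -> dot g x <= 0
                 & exists2 x, C x & dot g x < 0]).
Proof.
move=> + + /convex_coneP[P0 aP sP].
elim: s C => [|f s IH] C coneC [p ip] Ps; first by left; exists p.
have Pf : P f by apply: Ps; rewrite mem_head.
have Ps' : {in s, forall a, P a}.
  by move=> a sa; apply: Ps; rewrite in_cons sa orbT.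
have {}IH D coneD neD := IH D coneD neD Ps'.
have [C0 aC sC] := (convex_coneP _).1 coneC.
have [fge0|] := pselect (forall x, C x -> 0 <= dot f x).
  have [|[x ix sx]|] := IH C coneC; first by exists p.
    left; exists x => // a; rewrite in_cons => /predU1P[->|]; last exact: sx.
    by apply: fge0; case: ix.
  by right.
move=> /existsNP[y /not_implyP[Cy /negP]]; rewrite -ltNge => fy.
have [fle0|] := pselect (forall x, C x -> dot f x <= 0).
  by right; exists f; split => //; exists y.
move=> /existsNP[z /not_implyP[Cz /negP]]; rewrite -ltNge => fz.
pose Cge := C `&` [set x | 0 <= dot f x].
pose Ceq := C `&` [set x | dot f x = 0].
have coneCge : convex_cone Cge.
  apply/convex_coneP; split; first by split => //=; rewrite dot0r.
    move=> u v [Cu fu] [Cv fv]; split; first exact: aC.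
    by rewrite /= dotDr addr_ge0.
  move=> t u t0 [Cu fu]; split; first exact: sC.
  by rewrite /= dotZr mulr_ge0.
have coneCeq : convex_cone Ceq.
  apply/convex_coneP; split; first by split => //=; rewrite dot0r.
    move=> u v [Cu fu] [Cv fv]; split; first exact: aC.
    by rewrite /= dotDr fu fv addr0.
  move=> t u t0 [Cu fu]; split; first exact: sC.
  by rewrite /= dotZr fu mulr0.
(* Adding to [p] the right multiple of [y] or [z], whichever has the opposite sign under [f],
   cancels [f p] and stays in [icr C]. *)
have [q iq fq] : exists2 q, icr C q & dot f q = 0.
  have [fp|fp] := lerP 0 (dot f p).
    exists (p + (dot f p / - dot f y) *: y).
      by apply: icrD => //; apply: sC => //; apply: divr_ge0 => //; lra.
    by rewrite dotDr dotZr invrN mulrN mulNr divfK ?subrr ?lt_eqF.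
  exists (p + (- dot f p / dot f z) *: z).
    by apply: icrD => //; apply: sC => //; apply: divr_ge0; lra.
  by rewrite dotDr dotZr divfK ?subrr ?gt_eqF.
have icrCge : icr Cge `<=` icr C.
  apply: (@icr_subcone _ _ _ _ q) => //; first by move=> ? [].
  by split; [case: iq|rewrite /= fq].
have icrCeq : icr Ceq `<=` icr C.
  apply: (@icr_subcone _ _ _ _ q) => //; first by move=> ? [].
  by split; [case: iq|].
have Cge_ip : icr Cge (q + z).
  split; first by split; [apply/aC => //; case: iq|rewrite /= dotDr fq; lra].
  move=> w [Cw /= fw]; have [e e0 Cqw] := iq.2 w Cw.
  (* [d <= e] keeps the point in [C]; the other bound gives [d * f w <= f z], with [1 +] guarding
     against [f w = 0]. *)
  pose d := Num.min e (dot f z / (1 + dot f w)).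
  have d0 : 0 < d by rewrite lt_min e0 divr_gt0 //; lra.
  exists d => //; split.
    have -> : q + z - d *: w = (q - e *: w) + (z + (e - d) *: w).
      by rewrite scalerBl !addrA (addrAC (q - _)) subrK.
    apply/aC => //; apply/aC => //; apply: sC => //.
    by rewrite subr_ge0 ge_min lexx.
  rewrite /= !dotDr dotNr dotZr fq.
  have : d <= dot f z / (1 + dot f w) by rewrite ge_min lexx orbT.
  by rewrite ler_pdivlMr; lra.
have Ceq_iq : icr Ceq q.
  split; first by split => //; case: iq.
  move=> w [Cw /= fw]; have [e e0 Cqw] := iq.2 w Cw.
  by exists e => //; split => //=; rewrite dotDr dotNr dotZr fq fw; lra.
(* On [Cge] the multiplier of [f] can be chosen nonnegative, but the resulting
   combination may vanish on [C]; then a multiple of it makes the multiplier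
   obtained from [Ceq] nonnegative. *)
have [|[x ix sx]|[g [Pg g0 [v [Cv fv] gv]]]] := IH Cge coneCge.
- by exists (q + z).
- left; exists x; first exact: icrCge.
  by move=> a; rewrite in_cons => /predU1P[->|]; [case: ix => -[]|exact: sx].
have [|[x ix sx]|[h [Ph h0 [w [Cw fw] hw]]]] := IH Ceq coneCeq.
- by exists q.
- left; exists x; first exact: icrCeq.
  move=> a; rewrite in_cons => /predU1P[->|]; last exact: sx.
  by case: ix => -[_ /= ->].
have [mu mu0 gmu] : exists2 mu, 0 <= mu &
    forall x, C x -> dot g x + mu * dot f x <= 0.
  have [|nu gnu] := dot_ker_multiplier (g := g) coneC Cy fy Cz fz.
    by move=> x Cx fx; apply: g0; split => //=; rewrite fx.
  (* Where [f < 0], raising the multiplier lowers the sum; where [f >= 0], the multiplier 0 works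
     because [g <= 0] there. *)
  exists (Num.max 0 nu) => [|x Cx]; first by rewrite le_max lexx.
  have [fx|fx] := lerP 0 (dot f x).
    have gx : dot g x <= 0 by exact: g0.
    by have := gnu x Cx; case: (lerP 0 nu) => //; lra.
  by have := gnu x Cx; case: (lerP 0 nu) => //; nra.
have [[x Cx gx]|] := pselect (exists2 x, C x & dot g x + mu * dot f x < 0).
  right; exists (g + mu *: f); split; first by apply/aP => //; exact: sP.
    by move=> u Cu; rewrite dotDl dotZl; exact: gmu.
  by exists x => //; rewrite dotDl dotZl.
move=> /forall2NP gmu0.
have {}gmu0 x : C x -> dot g x + mu * dot f x = 0.
  move=> Cx; apply/eqP; rewrite eq_le gmu //= leNgt; apply/negP.
  by case: (gmu0 x).
(* For [mu = 0] the vanishing combination would be [g], which is negative at [v]. *)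
have mu_gt0 : 0 < mu.
  by have := gmu0 v Cv; rewrite lt_neqAle mu0 andbT eq_sym => gv0; apply/eqP; nra.
have [nu hnu] := dot_ker_multiplier coneC Cy fy Cz fz
  (fun x Cx fx => h0 x (conj Cx fx)).
pose t := `|nu| / mu.
have t0 : 0 <= t by rewrite divr_ge0.
have ge0 : 0 <= nu + t * mu.
  by rewrite /t divfK ?gt_eqF //; have := ler_norm (- nu); rewrite normrN; lra.
have dotE x : C x -> dot (h + t *: g + (nu + t * mu) *: f) x
    = dot h x + nu * dot f x.
  by move=> Cx; rewrite !dotDl !dotZl; have := gmu0 x Cx; nra.
right; exists (h + t *: g + (nu + t * mu) *: f); split.
- by apply/aP; [apply/aP => //; exact: sP|exact: sP].
- by move=> x Cx; rewrite dotE //; exact: hnu.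
- by exists w => //; rewrite dotE // (fw : dot f w = 0) mulr0 addr0.
Qed.

(** * Existence of relatively interior points, and agreement with the topological notion *)

(** Take a family in [C] of maximal rank: appending any [y] of [C] cannot raise the rank. *)
Lemma spanning_rows (R : realType) n (C : set 'rV[R]_n) :
  exists k (A : 'M[R]_(k, n)),
    (forall i, C (row i A)) /\ forall y, C y -> (y <= A)%MS.
Proof.
pose Q r := `[< exists k (A : 'M[R]_(k, n)),
  (forall i, C (row i A)) /\ \rank A = r >].
have exQ : exists r, Q r.
  by exists 0%N; apply/asboolP; exists 0%N, 0; split=> [[]//|]; rewrite mxrank0.
have ubQ r : Q r -> (r <= n)%N.
  by move=> /asboolP[k [A [_ <-]]]; exact: rank_leq_col.
case: (ex_maxnP exQ ubQ) => r /asboolP[k [A [CA rA]]] maxr.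
exists k, A; split=> // y Cy.
have : Q (\rank (col_mx A y)).
  apply/asboolP; exists (k + 1)%N, (col_mx A y); split=> // i.
  case: (split_ordP i) => j ->; first by rewrite rowKu.
  by rewrite rowKd row_id.
move=> /maxr; rewrite -rA => rle.
have sA : (A <= col_mx A y)%MS by rewrite -addsmxE addsmxSl.
have : (A == col_mx A y)%MS by rewrite -(geq_leqif (mxrank_leqif_eq sA)).
by move=> /eqmxP ->; rewrite -addsmxE addsmxSr.
Qed.

Lemma convex_cone_mulmx (R : realType) n k (C : set 'rV[R]_n)
    (v : 'rV[R]_k) (A : 'M[R]_(k, n)) :
  convex_cone C -> (forall i, 0 <= v 0 i) -> (forall i, C (row i A)) ->
  C (v *m A).
Proof.
move=> /convex_coneP[C0 aC sC] v0 CA; rewrite mulmx_sum_row.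
by apply: big_ind => // i _; exact: sC.
Qed.

(** The sum of a spanning family works: a point [v *m A], divided by [1 + \sum_i |v_i|], has all its
    coefficients at most 1. *)
Lemma icr_nonempty (R : realType) n (C : set 'rV[R]_n) :
  convex_cone C -> icr C !=set0.
Proof.
move=> coneC; have [k [A [CA spanA]]] := spanning_rows C.
exists (const_mx 1 *m A); split.
  by apply: convex_cone_mulmx => // i; rewrite mxE.
move=> y /spanA /mulmxKpV <-; move: (y *m pinvmx A) => v.
have s0 : 0 <= \sum_i `|v 0 i| by exact: sumr_ge0.
exists (1 + \sum_i `|v 0 i|)^-1; first by rewrite invr_gt0; lra.
rewrite scalemxAl -mulmxBl; apply: convex_cone_mulmx => // i.
rewrite !mxE subr_ge0 mulrC ler_pdivrMr ?mul1r; last by lra.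
rewrite (bigD1 i) //=; have := ler_norm (v 0 i).
have : 0 <= \sum_(j | j != i) `|v 0 j| by exact: sumr_ge0.
by lra.
Qed.

Lemma mulmx_continuous (R : realType) n k (P : 'M[R]_(n, k)) i :
  continuous (fun y : 'rV[R]_n => (y *m P) 0 i).
Proof.
have -> : (fun y : 'rV[R]_n => (y *m P) 0 i)
        = (fun y => \sum_j y 0 j * P j i) by apply/funext => y; rewrite mxE.
move=> x; have FF : Filter (nbhs x) := nbhs_filter x.
apply: cvg_big => [|j _]; first exact: add_continuous.
by apply: cvgMr_tmp; exact: coord_continuous.
Qed.

(** For [y] near [x] in the affine hull, the coefficients of [y - x] on a spanning family are at
    least [- e]. So [y] is [x] minus [e] times the sum of the family, a point of [C], plus a
    nonnegative combination. *)
Lemma icr_sub_ri (R : realType) n (C : set 'rV[R]_n) :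
  convex_cone C -> icr C `<=` ri C.
Proof.
move=> coneC x [Cx ix]; split=> //.
have [k [A [CA spanA]]] := spanning_rows C.
have [C0 aC sC] := (convex_coneP _).1 coneC.
have [|e e0 Cxe] := ix (const_mx 1 *m A).
  by apply: convex_cone_mulmx => // i; rewrite mxE.
have FF : Filter (nbhs x) := nbhs_filter x.
have near_coord i :
    \forall y \near x, (x *m pinvmx A) 0 i - e <= (y *m pinvmx A) 0 i.
  by apply: (cvgr_ge _ (@mulmx_continuous _ _ _ (pinvmx A) i x)); lra.
apply: filterS (filter_forall _ near_coord) => y hy [m [l [u [Cu l1 yE]]]].
have yA : (y <= A)%MS.
  by rewrite yE summx_sub // => i _; rewrite scalemx_sub // spanA.
have -> : y = (x - e *: (const_mx 1 *m A))
    + (e *: const_mx 1 + (y - x) *m pinvmx A) *m A.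
  rewrite (mulmxDl (e *: _)) mulmxKpV; last first.
    by rewrite addmx_sub ?eqmx_opp // spanA.
  by rewrite -scalemxAl addrA subrK addrC subrK.
apply/aC => //; apply: convex_cone_mulmx => // i.
have := hy i; rewrite mulmxBl; move: (y *m _) (x *m _) => v w.
by rewrite !mxE; lra.
Qed.

(** The line from [y] through [x] stays in the affine hull, so it can be prolonged in [C] slightly
    beyond [x]; rescaling makes the coefficient of [x] equal to 1. *)
Lemma ri_sub_icr (R : realType) n (C : set 'rV[R]_n) :
  convex_cone C -> ri C `<=` icr C.
Proof.
move=> /convex_coneP[C0 aC sC] x [Cx nx]; split=> // y Cy.
have lineE t : aff C (x + t *: (x - y)).
  exists 2, (fun i => if i == 0 then 1 + t else - t),
    (fun i => if i == 0 then x else y); split.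
  - by move=> i; case: ifP.
  - by rewrite !big_ord_recl big_ord0 /=; lra.
  - rewrite !big_ord_recl big_ord0 /= addr0 scalerDl scale1r scaleNr.
    by rewrite scalerBr addrA.
have cvg_line : x + t *: (x - y) @[t --> (0 : R)] --> x.
  rewrite -[X in _ --> X]addr0 -(scale0r (x - y)).
  apply: cvgD; first exact: cvg_cst.
  by apply: cvgZr_tmp; exact: cvg_id.
have /nbhs_ballP[e /= e0 He] := cvg_line _ nx.
have e20 : 0 < e / 2 by rewrite divr_gt0.
have : C (x + (e / 2) *: (x - y)).
  apply: He => //=; rewrite /ball /= sub0r normrN gtr0_norm //.
  lra.
move=> /(sC (1 + e / 2)^-1) H.
exists ((e / 2) / (1 + e / 2)); first by rewrite divr_gt0 //; lra.
have -> : x - (e / 2 / (1 + e / 2)) *: y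
        = (1 + e / 2)^-1 *: (x + (e / 2) *: (x - y)).
  rewrite scalerBr addrA -[X in X + _ - _]scale1r -scalerDl scalerBr !scalerA.
  by rewrite mulVf ?scale1r 1?mulrC // gt_eqF //; lra.
by apply: H; rewrite invr_ge0; lra.
Qed.

(** * Homogeneous inequalities for polyhedral cones, and the equivalence *)

(** Membership of 0 forces [b i <= 0], and a point with [dot (a i) x < 0] could be scaled until it
    violates the bound [b i]. *)
Lemma polyhedral_convex_cone (R : realType) n (C : set 'rV[R]_n) :
  convex_cone C -> polyhedral C ->
  exists m (a : 'I_m -> 'rV[R]_n), C = [set x | forall i, 0 <= dot (a i) x].
Proof.
move=> /convex_coneP[C0 aC sC] [m [a [b CE]]]; exists m, a.
apply/seteqP; split=> x /= Cx; last first.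
  rewrite CE => i; apply: le_trans (Cx i).
  by move: C0; rewrite CE => /(_ i); rewrite dot0r.
move=> i; rewrite leNgt; apply/negP => ax.
have b0 : b i <= 0 by move: C0; rewrite CE => /(_ i); rewrite dot0r.
have : C (((1 - b i) / - dot (a i) x) *: x).
  by apply: sC => //; rewrite divr_ge0 //; lra.
rewrite CE => /(_ i); rewrite dotZr invrN mulrN mulNr divfK ?lt_eqF //.
lra.
Qed.

Theorem corollary5 (R : realType) (n1 n2 : nat)
    (K1 : set 'rV[R]_n1) (K2 : set 'rV[R]_n2)
    (L : {vspace 'rV[R]_(n1 + n2)})
    (cone1 : convex_cone K1) (closed1 : closed K1)
    (cone2 : convex_cone K2) (closed2 : closed K2)
    (poly2 : polyhedral K2) :
  dual (prodset K1 K2) `&` orth L `<=` prodset (lin (dual K1)) (dual K2)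
  <->
  (prodset (ri K1) K2 `&` [set` L]) !=set0.
Proof.
have [K10 aK1 sK1] := (convex_coneP _).1 cone1.
have [K20 aK2 sK2] := (convex_coneP _).1 cone2.
split; last first.
  move=> [x [[/(ri_sub_icr cone1) [K1x ix] K2x] xL]] s [sK sL].
  have s1 : dual K1 (lsubmx s).
    move=> y K1y; have := sK (row_mx y 0).
    rewrite dot_split row_mxKl row_mxKr dot0r addr0; apply.
    by split; rewrite ?row_mxKl ?row_mxKr.
  have s2 : dual K2 (rsubmx s).
    move=> y K2y; have := sK (row_mx 0 y).
    rewrite dot_split row_mxKl row_mxKr dot0r add0r; apply.
    by split; rewrite ?row_mxKl ?row_mxKr.
  (* The two nonnegative parts of [dot s x] sum to 0, so [lsubmx s] vanishes at [lsubmx x]; its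
     nonnegativity at [lsubmx x - e *: y] then gives the opposite sign at [y]. *)
  do 2![split => //]; move=> y K1y /=; rewrite dotNl.
  have := sL x xL; rewrite dot_split.
  have := s1 _ K1x; have := s2 _ K2x.
  have [e e0 /s1] := ix y K1y; rewrite dotDr dotNr dotZr.
  by nra.
move=> sub.
have [m [a K2E]] := polyhedral_convex_cone cone2 poly2.
have [l [lL Ll]] := orth_separates L.
pose C := prodset K1 [set: 'rV[R]_n2].
(* This is the cone [orth L + (0 x dual K2)], which contains every functional of [s] below. *)
pose P := [set v : 'rV[R]_(n1 + n2) |
  exists2 b, dual K2 b & orth L (v - row_mx 0 b)].
have coneC : convex_cone C.
  apply/convex_coneP; split; first by split => //; rewrite linear0.
    by move=> x y [? _] [? _]; split => //; rewrite linearD; exact: aK1.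
  by move=> t x t0 [? _]; split => //; rewrite linearZ; exact: sK1.
have coneP : convex_cone P.
  apply/convex_coneP; split.
  - exists 0 => [x _|x xL]; first by rewrite dot0l.
    by rewrite row_mx0 subr0 dot0l.
  - move=> u v [b b0 ub] [c c0 vc]; exists (b + c) => [x K2x|x xL].
      by rewrite dotDl addr_ge0 ?b0 ?c0.
    have := ub x xL; have := vc x xL.
    have -> : row_mx 0 (b + c) = row_mx 0 b + row_mx 0 c :> 'rV[R]_(n1 + n2).
      by rewrite add_row_mx addr0.
    rewrite !(dotDl, dotNl).
    lra.
  - move=> t u t0 [b b0 ub]; exists (t *: b) => [x K2x|x xL].
      by rewrite dotZl mulr_ge0 ?b0.
    have -> : row_mx 0 (t *: b) = t *: row_mx 0 b :> 'rV[R]_(n1 + n2).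
      by rewrite scale_row_mx scaler0.
    by rewrite -scalerBr dotZl ub // mulr0.
have [x0 ix0] := icr_nonempty cone1.
have icrC : icr C !=set0.
  exists (row_mx x0 0); split; first by split => //; rewrite row_mxKl; case: ix0.
  move=> y [K1y _]; have [e e0 K1e] := ix0.2 _ K1y.
  by exists e => //; split => //; rewrite linearB linearZ /= row_mxKl.
pose s := l ++ [seq - v | v <- l] ++ [seq row_mx 0 (a i) | i : 'I_m].
have Ps : {in s, forall v, P v}.
  move=> v; rewrite !mem_cat => /or3P[vl|/mapP[w wl ->]|/mapP[i _ ->]].
  - exists 0 => [x _|x xL]; first by rewrite dot0l.
    by rewrite row_mx0 subr0 lL.
  - exists 0 => [x _|x xL]; first by rewrite dot0l.
    by rewrite row_mx0 subr0 dotNl lL // oppr0.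
  - exists (a i) => [x|x xL]; last by rewrite subrr dot0l.
    by rewrite K2E; exact.
have [[x [[K1x _] ix] sx]|[g [[b b0 gb] gC [z Cz gz]]]] :=
    mixed_alternative coneC icrC coneP Ps.
  exists x; split; last first.
    apply: Ll => v vl; apply/eqP; rewrite eq_le sx ?andbT; last first.
      by rewrite mem_cat vl.
    rewrite -oppr_ge0 -dotNl sx // !mem_cat; apply/or3P/Or32.
    exact: map_f.
  split.
    apply: icr_sub_ri => //; split=> // y K1y.
    have [|e e0 [K1e _]] := ix (row_mx y 0); first by split; rewrite ?row_mxKl.
    by exists e => //; move: K1e; rewrite linearB linearZ /= row_mxKl.
  rewrite K2E => i; have := sx (row_mx 0 (a i)).
  rewrite dot_split row_mxKl row_mxKr dot0l add0r; apply.
  rewrite !mem_cat; apply/or3P/Or33; apply: map_f; exact: mem_enum.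
(* The second factor of [C] is the whole space, so [g] can be tested on its own second component. *)
have g2 : rsubmx g = 0.
  apply: dot_le0_eq0; have := gC (row_mx 0 (rsubmx g)).
  rewrite dot_split row_mxKl row_mxKr dot0r add0r; apply.
  by split; rewrite ?row_mxKl.
(* If the first component of this element were in [lin (dual K1)], [g] would be nonnegative at
   [z]. *)
have [|[_ g1] _] := sub (row_mx 0 b - g).
  split=> [x [K1x K2x]|x xL]; last first.
    by have := gb x xL; rewrite !dotDl !dotNl; lra.
  have := gC x; rewrite dotDl dotNl !dot_split g2 row_mxKl row_mxKr !dot0l.
  have := b0 _ K2x => b0x gx.
  have : dot (lsubmx g) (lsubmx x) + 0 <= 0 by apply: gx.
  lra.
have := g1 (lsubmx z) Cz.1.
rewrite linearB /= row_mxKl sub0r opprK.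
by move: gz; rewrite dot_split g2 dot0l; lra.
Qed.
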